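(* $(\mathfrak h_3\oplus\mathbb R,S_0^3,J)$ is a second kind algebraic Ricci soliton with respect to $\nabla^0$ with $c=-\frac58$: the linear map $D$ represented in the basis $\{v_1,v_2,v_3,v_4\}$ by $$\begin{bmatrix}\frac38&0&0&0\\0&\frac78&0&0\\0&0&\frac38&-\frac18\\0&0&\frac18&\frac58\end{bmatrix}$$ is a derivation of $\mathfrak h_3\oplus\mathbb R$, and $\widetilde{\operatorname{Ric}}^0=-\frac58\operatorname{Id}+D$.
   Context: $\mathfrak h_3\oplus\mathbb R$ is the real Lie algebra with basis $e_1,e_2,e_3,e_4$ and only non-zero bracket (up to skew-symmetry) $[e_1,e_2]=e_3$. $S_0^3$ is the Lorentzian inner product $\langle\cdot,\cdot\rangle$ whose matrix in $(e_1,e_2,e_3,e_4)$ is $\begin{bmatrix}1&0&0&0\\0&0&0&1\\0&0&1&0\\0&1&0&0\end{bmatrix}$. Fix the basis $v_1=e_1$, $v_2=e_3$, $v_3=\frac1{\sqrt2}(e_2+e_4)$, $v_4=\frac1{\sqrt2}(e_2-e_4)$, which is orthonormal: $\langle v_i,v_j\rangle=0$ for $i\ne j$, $\langle v_i,v_i\rangle=1$ for $i=1,2,3$, $\langle v_4,v_4\rangle=-1$. The product structure $J$ is the linear map with $Jv_i=v_i$ for $i=1,2,3$ and $Jv_4=-v_4$. Write $\mathfrak g$ for the Lie algebra. The Levi-Civita connection is the bilinear map $\nabla:\mathfrak g\times\mathfrak g\to\mathfrak g$ with $2\langle\nabla_uv,w\rangle=\langle[u,v],w\rangle+\langle[w,u],v\rangle+\langle[w,v],u\rangle$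 for all $u,v,w$. Put $(\nabla_uJ)v=\nabla_u(Jv)-J(\nabla_uv)$. The canonical connection is $\nabla^0_uv=\nabla_uv-\frac12(\nabla_uJ)Jv$. Its curvature is $R^0_{uv}w=\nabla^0_{[u,v]}w-\nabla^0_u\nabla^0_vw+\nabla^0_v\nabla^0_uw$, its Ricci operator is $\operatorname{Ric}^0(u)=\sum_{k=1}^4\langle v_k,v_k\rangle R^0_{v_ku}v_k$, and $\rho^0(u,v)=\langle\operatorname{Ric}^0(u),v\rangle$. Put $\widetilde\rho^0(u,v)=\frac12(\rho^0(u,v)+\rho^0(v,u))$ and define $\widetilde{\operatorname{Ric}}^0$ by $\langle\widetilde{\operatorname{Ric}}^0(u),v\rangle=\widetilde\rho^0(u,v)$. A derivation of $\mathfrak g$ is a linear map $D:\mathfrak g\to\mathfrak g$ with $[D(u),v]+[u,D(v)]=D[u,v]$ for all $u,v\in\mathfrak g$. Second kind algebraic Ricci soliton with respect to $\nabla^0$ means $\widetilde{\operatorname{Ric}}^0=c\operatorname{Id}+D$ for some $c\in\mathbb R$ and some derivation $D$. In matrices, the $j$-th column contains the coordinates of the image of $v_j$ in the basis $(v_1,v_2,v_3,v_4)$. *)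

(* Defs.v *)
From HB Require Import structures.
From mathcomp Require Import all_boot all_order all_algebra.
From mathcomp Require Import reals.
From mathcomp Require Import ring.

Set Implicit Arguments.
Unset Strict Implicit.
Unset Printing Implicit Defensive.

Import Order.TTheory GRing.Theory Num.Theory.
Local Open Scope ring_scope.

Section Connections.
Variables (R : realType) (V : lmodType R).
Variables (br : V -> V -> V) (ip : V -> V -> R).

Definition bilinear_map (f : V -> V -> V) : Prop :=
  (forall u, linear (f u)) /\ (forall v, linear (f^~ v)).

Definition is_levi_civita (nabla : V -> V -> V) : Prop :=
  bilinear_map nabla /\
  forall u v w,
    2 * ip (nabla u v) w = ip (br u v) w + ip (br w u) v + ip (br w v) u.

(* (nabla_u J) v *)
Definition cov_deriv (nabla : V -> V -> V) (J : V -> V) (u v : V) : V :=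
  nabla u (J v) - J (nabla u v).

Definition canonical_connection (nabla : V -> V -> V) (J : V -> V)
    (u v : V) : V :=
  nabla u v - 2^-1 *: cov_deriv nabla J u (J v).

(* The sign convention is R_{uv} = nabla_{[u,v]} - [nabla_u, nabla_v]. *)
Definition curvature (nabla : V -> V -> V) (u v w : V) : V :=
  nabla (br u v) w - nabla u (nabla v w) + nabla v (nabla u w).

(* [b] is meant to be an orthonormal basis, so that [ip (b k) (b k)] is the
   sign of [b k]. *)
Definition ricci_op (n : nat) (b : 'I_n -> V) (nabla : V -> V -> V)
    (u : V) : V :=
  \sum_(k < n) ip (b k) (b k) *: curvature nabla (b k) u (b k).

Definition ricci_form n (b : 'I_n -> V) (nabla : V -> V -> V) (u v : V) : R :=
  ip (ricci_op b nabla u) v.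

Definition sym_ricci_form n (b : 'I_n -> V) (nabla : V -> V -> V)
    (u v : V) : R :=
  2^-1 * (ricci_form b nabla u v + ricci_form b nabla v u).

Definition is_sym_ricci_op n (b : 'I_n -> V) (nabla : V -> V -> V)
    (Ric : V -> V) : Prop :=
  forall u v, ip (Ric u) v = sym_ricci_form b nabla u v.

Definition is_derivation (D : V -> V) : Prop :=
  forall u v, br (D u) v + br u (D v) = D (br u v).

(* "Second kind" means that [Ric] is the symmetrized Ricci operator. *)
Definition algebraic_ricci_soliton (Ric : V -> V) (c : R) : Prop :=
  exists D : {linear V -> V},
    is_derivation D /\ forall u, Ric u = c *: u + D u.

(* The j-th column of [M] holds the coordinates of [D (b j)] in [b]. *)
Definition represented_by n (b : 'I_n -> V) (D : V -> V) (M : 'M[R]_n) : Prop :=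
  forall j, D (b j) = \sum_(i < n) M i j *: b i.

End Connections.

Section H3R.
Variable R : realType.

Definition mx_of_rows n (s : seq (seq R)) : 'M[R]_n :=
  \matrix_(i, j) nth 0 (nth [::] s i) j.

(* Elements of h_3 + R are columns of coordinates in (e_1, ..., e_4); indices
   start at 0, so that e_i is [ebasis (i-1)]. *)
Notation h3R := 'cV[R]_4.

Definition ebasis (i : 'I_4) : h3R := delta_mx i 0.

Definition h3R_bracket (u v : h3R) : h3R :=
  (u 0 0 * v 1 0 - u 1 0 * v 0 0) *: ebasis 2.

Definition S03_mx : 'M[R]_4 := mx_of_rows 4
  [:: [:: 1; 0; 0; 0];
      [:: 0; 0; 0; 1];
      [:: 0; 0; 1; 0];
      [:: 0; 1; 0; 0]].

Definition S03 (u v : h3R) : R := (u^T *m S03_mx *m v) 0 0.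

(* v_i is [vframe (i-1)]. *)
Definition vframe (i : 'I_4) : h3R :=
  nth 0 [:: ebasis 0; ebasis 2;
            (Num.sqrt 2)^-1 *: (ebasis 1 + ebasis 3);
            (Num.sqrt 2)^-1 *: (ebasis 1 - ebasis 3)] i.

Definition vsign (i : 'I_4) : R := if i == 3 then -1 else 1.

Definition is_product_structure_J (J : h3R -> h3R) : Prop :=
  forall i, J (vframe i) = vsign i *: vframe i.

Definition soliton_D_mx : 'M[R]_4 := mx_of_rows 4
  [:: [:: 3/8; 0;   0;   0];
      [:: 0;   7/8; 0;   0];
      [:: 0;   0;   3/8; - (1/8)];
      [:: 0;   0;   1/8; 5/8]].

(* The following facts show that [h3R_bracket] is a Lie bracket, that [vframe]
   is orthonormal, and that the objects characterised by [is_product_structure_J],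
   [is_levi_civita] and [is_sym_ricci_op] exist and are unique. *)

Lemma ord4P (P : 'I_4 -> Prop) : P 0 -> P 1 -> P 2 -> P 3 -> forall i, P i.
Proof.
move=> P0 P1 P2 P3 [[|[|[|[|m]]]] Hm] //.
- by rewrite (_ : Ordinal Hm = 0) //; apply: val_inj.
- by rewrite (_ : Ordinal Hm = 1) //; apply: val_inj.
- by rewrite (_ : Ordinal Hm = 2) //; apply: val_inj.
- by rewrite (_ : Ordinal Hm = 3) //; apply: val_inj.
Qed.

Lemma sum_ord4 (W : nmodType) (F : 'I_4 -> W) :
  \sum_(i < 4) F i = F 0 + F 1 + F 2 + F 3.
Proof.
rewrite !big_ord_recr big_ord0 /= add0r.
by congr (F _ + F _ + F _ + F _); apply: val_inj.
Qed.

Lemma h3R_bracketE u v i :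
  h3R_bracket u v i 0 = if i == 2 then u 0 0 * v 1 0 - u 1 0 * v 0 0 else 0.
Proof.
by rewrite /h3R_bracket /ebasis !mxE andbT; case: eqP => _; rewrite ?mulr1 ?mulr0.
Qed.

Lemma h3R_bracket_ebasis i j :
  h3R_bracket (ebasis i) (ebasis j) =
  if (i == 0) && (j == 1) then ebasis 2
  else if (i == 1) && (j == 0) then - ebasis 2 else 0.
Proof.
apply/colP => k; rewrite h3R_bracketE !mxE !andbT.
by elim/ord4P: i; elim/ord4P: j; elim/ord4P: k; rewrite /= ?mxE /=; ring.
Qed.

Lemma h3R_bracket_bilinear : bilinear_map h3R_bracket.
Proof.
by split=> u a v w; apply/colP => i; rewrite !(h3R_bracketE, mxE);
  case: (i == 2); ring.
Qed.

Lemma h3R_bracket_alt u : h3R_bracket u u = 0.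
Proof.
by apply/colP => i; rewrite h3R_bracketE mxE; case: (i == 2); ring.
Qed.

Lemma h3R_jacobi u v w :
  h3R_bracket u (h3R_bracket v w) + h3R_bracket v (h3R_bracket w u)
  + h3R_bracket w (h3R_bracket u v) = 0.
Proof.
apply/colP => i; rewrite !(h3R_bracketE, mxE) /=.
by case: (i == 2); ring.
Qed.

Lemma S03E u v :
  S03 u v = u 0 0 * v 0 0 + u 1 0 * v 3 0 + u 2 0 * v 2 0 + u 3 0 * v 1 0.
Proof.
rewrite /S03 /S03_mx /mx_of_rows.
by rewrite !(mxE, sum_ord4) /=; ring.
Qed.

Lemma S03C u v : S03 u v = S03 v u.
Proof. by rewrite !S03E; ring. Qed.

Lemma S03Dl a x y w : S03 (a *: x + y) w = a * S03 x w + S03 y w.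
Proof. by rewrite !S03E !mxE; ring. Qed.

Lemma S03Dr a x y w : S03 w (a *: x + y) = a * S03 w x + S03 w y.
Proof. by rewrite !S03E !mxE; ring. Qed.

Lemma S03_nondegenerate u u' : (forall v, S03 u v = S03 u' v) -> u = u'.
Proof.
move=> h; apply/colP => i.
have := (h (ebasis 0), h (ebasis 1), h (ebasis 2), h (ebasis 3)).
rewrite !S03E !mxE /= !(mulr0, mulr1, addr0, add0r) => -[[[h0 h1] h2] h3].
by elim/ord4P: i.
Qed.

Lemma vframe_orthonormal i j :
  S03 (vframe i) (vframe j) = if i == j then vsign i else 0.
Proof.
have s2 : (Num.sqrt 2 : R)^-1 * (Num.sqrt 2)^-1 = 2^-1.
  by rewrite -invfM -expr2 sqr_sqrtr.
rewrite S03E /vframe /vsign /ebasis.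
by elim/ord4P: i; elim/ord4P: j; rewrite /= !mxE /=
  ?(mulr0, mul0r, mulr1, mul1r, addr0, add0r, subr0, sub0r, oppr0,
    mulrN, mulNr, opprK, mulrN1) ?s2; field.
Qed.

Lemma h3R_ebasisE (u : h3R) : u = \sum_(k < 4) u k 0 *: ebasis k.
Proof.
apply/colP => i; rewrite sum_ord4 !mxE /= !andbT.
by elim/ord4P: i; rewrite /= !(mulr0, mulr1, addr0, add0r).
Qed.

Lemma vframe_span (u : h3R) : exists c : 'I_4 -> R, u = \sum_(k < 4) c k *: vframe k.
Proof.
have s2 : (Num.sqrt 2 : R) != 0 by rewrite sqrtr_eq0 -ltNge ltr0n.
exists (fun k => nth 0 [:: u 0 0; u 2 0;
  Num.sqrt 2 / 2 * (u 1 0 + u 3 0); Num.sqrt 2 / 2 * (u 1 0 - u 3 0)] k).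
apply/colP => i; rewrite sum_ord4 /vframe /ebasis !mxE /= !andbT.
by elim/ord4P: i; rewrite /= ?(mulr0, mulr1, addr0, add0r, subr0, sub0r) //; field.
Qed.

Lemma product_structure_J_ex :
  exists J : {linear h3R -> h3R}, is_product_structure_J J.
Proof.
exists (mulmx S03_mx) => i; apply/colP => j.
rewrite !(mxE, sum_ord4) /vframe /vsign /ebasis.
by elim/ord4P: i; elim/ord4P: j; rewrite /= !mxE /=; ring.
Qed.

Lemma product_structure_J_uniq (J J' : {linear h3R -> h3R}) :
  is_product_structure_J J -> is_product_structure_J J' -> J =1 J'.
Proof.
move=> hJ hJ' u; have [c ->] := vframe_span u.
by rewrite !linear_sum; apply: eq_bigr => k _; rewrite !linearZ /= hJ hJ'.
Qed.

Lemma S03_represent (f : h3R -> R) :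
  scalar f -> forall w, S03 (S03_mx *m \col_k f (ebasis k)) w = f w.
Proof.
move=> lf w.
have f0 : f 0 = 0 by have := lf (-1) 0 0; rewrite scaler0 addr0 mulN1r addNr.
have fD x y : f (x + y) = f x + f y by have := lf 1 x y; rewrite scale1r mul1r.
have fZ a x : f (a *: x) = a * f x by have := lf a x 0; rewrite f0 !addr0.
rewrite [in RHS](h3R_ebasisE w) S03E sum_ord4 !fD !fZ.
by rewrite !(mxE, sum_ord4) /=; ring.
Qed.

Lemma levi_civita_ex :
  exists nabla, is_levi_civita h3R_bracket S03 nabla.
Proof.
pose f u v w := 2^-1 * (S03 (h3R_bracket u v) w + S03 (h3R_bracket w u) v
                        + S03 (h3R_bracket w v) u).
have [brr brl] := h3R_bracket_bilinear.
have lf u v : scalar (f u v).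
  by move=> a x y; rewrite /f !brl !S03Dl S03Dr; ring.
exists (fun u v => S03_mx *m \col_k f u v (ebasis k)); split; last first.
  by move=> u v w; rewrite S03_represent // /f; field.
by split=> [u a x y|v a x y] /=; apply: S03_nondegenerate => w;
  rewrite S03Dl !S03_represent // /f ?brl ?brr ?(S03Dl, S03Dr); ring.
Qed.

Lemma levi_civita_uniq nabla nabla' :
  is_levi_civita h3R_bracket S03 nabla ->
  is_levi_civita h3R_bracket S03 nabla' ->
  forall u v, nabla u v = nabla' u v.
Proof.
move=> [_ h] [_ h'] u v; apply: S03_nondegenerate => w.
apply: (@mulfI _ 2); first by rewrite pnatr_eq0.
by rewrite h h'.
Qed.

Lemma sym_ricci_op_ex n (b : 'I_n -> h3R) (nabla : h3R -> h3R -> h3R) :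
  bilinear_map nabla ->
  exists Ric, is_sym_ricci_op h3R_bracket S03 b nabla Ric.
Proof.
move=> [nr nl].
have lric : linear (ricci_op h3R_bracket S03 b nabla).
  move=> a x y; rewrite /ricci_op scaler_sumr -big_split; apply: eq_bigr => k _.
  rewrite /curvature /= (proj1 h3R_bracket_bilinear) !nl nr.
  by apply/colP => i; rewrite !mxE; ring.
exists (fun u => S03_mx *m \col_k sym_ricci_form h3R_bracket S03 b nabla u (ebasis k)).
move=> u v; rewrite (S03_represent (f := sym_ricci_form _ _ b nabla u)) // => a x y.
by rewrite /sym_ricci_form /ricci_form lric S03Dr S03Dl; ring.
Qed.

Lemma sym_ricci_op_uniq n (b : 'I_n -> h3R) nabla Ric Ric' :
  is_sym_ricci_op h3R_bracket S03 b nabla Ric ->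
  is_sym_ricci_op h3R_bracket S03 b nabla Ric' -> Ric =1 Ric'.
Proof.
by move=> h h' u; apply: S03_nondegenerate => w; rewrite h h'.
Qed.

End H3R.

(* Main.v *)
(* Everything is computed in the coordinates of (e_1, ..., e_4), in which J
   exchanges e_2 and e_4. The Koszul formula then determines the connection
   explicitly. As R^0_{v_k u} v_k is quadratic in v_k, the factor 1/sqrt 2 in
   v_3 and v_4 enters only through its square, and the contribution of v_4 to
   the Ricci operator vanishes. *)

From HB Require Import structures.
Require Import Defs.
From mathcomp Require Import all_boot all_order all_algebra reals.
From mathcomp Require Import ring.
Set Implicit Arguments.
Unset Strict Implicit.
Unset Printing Implicit Defensive.
Import Order.TTheory GRing.Theory Num.Theory.
Local Open Scope ring_scope.

Section Computation.
Variable R : realType.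
Notation h3R := 'cV[R]_4.

(** Explicit columns turn every vector identity below into four scalar ones for [ring] or
    [field]. *)
Definition col4 (a b c d : R) : h3R := \col_i nth 0 [:: a; b; c; d] i.

Lemma col4E a b c d :
  (col4 a b c d 0 0 = a) * (col4 a b c d 1 0 = b) *
  (col4 a b c d 2 0 = c) * (col4 a b c d 3 0 = d).
Proof. by rewrite /col4 !mxE. Qed.

Lemma col4P (u : h3R) a b c d :
  u 0 0 = a -> u 1 0 = b -> u 2 0 = c -> u 3 0 = d -> u = col4 a b c d.
Proof. by move=> *; apply/colP; elim/ord4P; rewrite col4E. Qed.

Lemma col4_eta (u : h3R) : u = col4 (u 0 0) (u 1 0) (u 2 0) (u 3 0).
Proof. exact: col4P. Qed.

Lemma col4D a b c d a' b' c' d' :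
  col4 a b c d + col4 a' b' c' d' = col4 (a + a') (b + b') (c + c') (d + d').
Proof. by apply: col4P; rewrite mxE !col4E. Qed.

Lemma col4N a b c d : - col4 a b c d = col4 (- a) (- b) (- c) (- d).
Proof. by apply: col4P; rewrite mxE !col4E. Qed.

Lemma bracket_col4 a b c d a' b' c' d' :
  h3R_bracket (col4 a b c d) (col4 a' b' c' d') = col4 0 0 (a * b' - b * a') 0.
Proof. by apply: col4P; rewrite h3R_bracketE ?col4E. Qed.

Lemma vframe_col4 :
  (vframe R 0 = col4 1 0 0 0) * (vframe R 1 = col4 0 0 1 0) *
  (vframe R 2 = col4 0 (Num.sqrt 2)^-1 0 (Num.sqrt 2)^-1) *
  (vframe R 3 = col4 0 (Num.sqrt 2)^-1 0 (- (Num.sqrt 2)^-1)).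
Proof.
by do !split; apply: col4P; rewrite /vframe /ebasis /= !mxE /=; ring.
Qed.

Lemma sqrt2_neq0 : (Num.sqrt 2 : R) != 0.
Proof. by rewrite sqrtr_eq0 -ltNge ltr0n. Qed.

Lemma product_structure_JE (J : {linear h3R -> h3R}) :
  is_product_structure_J J ->
  forall u, J u = col4 (u 0 0) (u 3 0) (u 2 0) (u 1 0).
Proof.
(* The Gram matrix, read as an operator, swaps $e_2$ and $e_4$, so it has the eigenvectors
   prescribed for [J]; uniqueness then identifies the two. *)
have hS : is_product_structure_J (mulmx (S03_mx R)).
  move=> i; apply/colP.
  by elim/ord4P: i; elim/ord4P; rewrite !vframe_col4 /vsign;
    rewrite !(col4E, mxE, sum_ord4) /=; ring.
move=> hJ u; rewrite (product_structure_J_uniq hJ hS).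
by apply: col4P; rewrite !(mxE, sum_ord4) /=; ring.
Qed.

Lemma levi_civitaE (nabla : h3R -> h3R -> h3R) :
  is_levi_civita (@h3R_bracket R) (@S03 R) nabla ->
  forall u v, nabla u v =
    col4 ((u 1 0 * v 2 0 + u 2 0 * v 1 0) / 2) 0
         ((u 0 0 * v 1 0 - u 1 0 * v 0 0) / 2)
         (- (u 0 0 * v 2 0 + u 2 0 * v 0 0) / 2).
Proof.
(* The explicit formula is checked, not derived: twice its product with any [w] matches the Koszul
   expression. *)
move=> [_ hn] u v; apply: S03_nondegenerate => w.
apply: (@mulfI _ 2); first by rewrite pnatr_eq0.
by rewrite hn !S03E !h3R_bracketE !col4E /=; field.
Qed.

Section Canonical.
Variables (J : {linear h3R -> h3R}) (nabla : h3R -> h3R -> h3R).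
Hypotheses (hJ : is_product_structure_J J)
  (hnabla : is_levi_civita (@h3R_bracket R) (@S03 R) nabla).

(** As $J^2=1$, $\nabla^0_uv$ is the mean of $\nabla_uv$ and $J\nabla_uJv$; this makes its second
    and fourth coordinates equal. *)
Lemma canonical_connectionE u v :
  canonical_connection nabla J u v =
    col4 (u 1 0 * v 2 0 / 2 + u 2 0 * (v 1 0 + v 3 0) / 4)
         (- (u 0 0 * v 2 0 + u 2 0 * v 0 0) / 4)
         (u 0 0 * (v 1 0 + v 3 0) / 4 - u 1 0 * v 0 0 / 2)
         (- (u 0 0 * v 2 0 + u 2 0 * v 0 0) / 4).
Proof.
rewrite /canonical_connection /cov_deriv !(levi_civitaE hnabla) !(product_structure_JE hJ).
by apply: col4P; rewrite !(col4E, mxE); field.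
Qed.

Notation nabla0 := (canonical_connection nabla J).
Notation curv0 := (curvature (@h3R_bracket R) nabla0).

(** In this form the nested connections of the curvature rewrite to explicit columns again. *)
Lemma canonical_connection_col4 a b c d a' b' c' d' :
  nabla0 (col4 a b c d) (col4 a' b' c' d') =
    col4 (b * c' / 2 + c * (b' + d') / 4) (- (a * c' + c * a') / 4)
         (a * (b' + d') / 4 - b * a' / 2) (- (a * c' + c * a') / 4).
Proof. by rewrite canonical_connectionE !col4E. Qed.

Lemma canonical_curvature_e1 u :
  curv0 (col4 1 0 0 0) u (col4 1 0 0 0) =
  col4 0 (- (3 / 8) * u 1 0) (u 2 0 / 8) (- (3 / 8) * u 1 0).
Proof.
rewrite [u in LHS]col4_eta /curvature bracket_col4.
rewrite !canonical_connection_col4 !col4N !col4D.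
by congr col4; field.
Qed.

Lemma canonical_curvature_e3 u :
  curv0 (col4 0 0 1 0) u (col4 0 0 1 0) =
  col4 (u 0 0 / 8) (u 1 0 / 8) 0 (u 1 0 / 8).
Proof.
rewrite [u in LHS]col4_eta /curvature bracket_col4.
rewrite !canonical_connection_col4 !col4N !col4D.
by congr col4; field.
Qed.

(* For v_3 and v_4, s = 1/sqrt 2 and t = s, resp. t = -s, so that s (s + t) is
   1, resp. 0. *)
Lemma canonical_curvature_e24 s t u :
  curv0 (col4 0 s 0 t) u (col4 0 s 0 t) =
  col4 (- (3 / 8) * (s * (s + t)) * u 0 0) 0 (s * (s + t) * u 2 0 / 8) 0.
Proof.
rewrite [u in LHS]col4_eta /curvature bracket_col4.
rewrite !canonical_connection_col4 !col4N !col4D.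
by congr col4; field.
Qed.

Lemma canonical_ricci_opE u :
  ricci_op (@h3R_bracket R) (@S03 R) (@vframe R) nabla0 u =
  col4 (- u 0 0 / 4) (- u 1 0 / 4) (u 2 0 / 4) (- u 1 0 / 4).
Proof.
have s_neq0 := sqrt2_neq0.
have s2 : (Num.sqrt 2 : R)^-1 * ((Num.sqrt 2)^-1 + (Num.sqrt 2)^-1) = 1.
  have h : (Num.sqrt 2 : R) ^+ 2 = 2 by rewrite sqr_sqrtr.
  by field: h.
rewrite /ricci_op sum_ord4 !vframe_orthonormal /vsign /= !vframe_col4.
rewrite canonical_curvature_e1 canonical_curvature_e3 !canonical_curvature_e24.
rewrite s2 subrr.
by apply: col4P; rewrite !(col4E, mxE); field.
Qed.

(** $\rho^0$ is not symmetric: $\rho^0(e_2,e_4)=-\frac14$ but $\rho^0(e_4,e_2)=0$. Their mean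
    $-\frac18$ gives the two coefficients with denominator 8. *)
Lemma canonical_sym_ricci_opE (Ric : h3R -> h3R) :
  is_sym_ricci_op (@h3R_bracket R) (@S03 R) (@vframe R)
    (canonical_connection nabla J) Ric ->
  forall u, Ric u =
    col4 (- u 0 0 / 4) (- u 1 0 / 8) (u 2 0 / 4) (- u 1 0 / 4 - u 3 0 / 8).
Proof.
move=> hRic u; apply: S03_nondegenerate => w.
rewrite hRic /sym_ricci_form /ricci_form !canonical_ricci_opE !S03E !col4E.
by field.
Qed.

End Canonical.

(** This is $\widetilde{\operatorname{Ric}}^0+\frac58\operatorname{Id}$ in the basis $(e_i)$. The
    constant solves $(-\frac14-c)+(-\frac18-c)=\frac14-c$, the derivation condition on
    $[e_1,e_2]=e_3$. *)
Definition soliton_D (u : h3R) : h3R :=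
  col4 (3 / 8 * u 0 0) (u 1 0 / 2) (7 / 8 * u 2 0) (u 3 0 / 2 - u 1 0 / 4).

Lemma soliton_D_linear : linear soliton_D.
Proof. by move=> a u v; apply/esym/col4P; rewrite !(col4E, mxE); ring. Qed.

HB.instance Definition _ :=
  GRing.isLinear.Build R h3R h3R *:%R soliton_D soliton_D_linear.

(** The weights of $e_1$ and $e_2$ add up to that of $e_3$, $\frac38+\frac12=\frac78$, and the extra
    term $-\frac14e_4$ in the image of $e_2$ is central. *)
Lemma soliton_D_derivation : is_derivation (@h3R_bracket R) soliton_D.
Proof.
by move=> u v; apply: col4P; rewrite !(col4E, h3R_bracketE, mxE) /=; field.
Qed.

(** The lower $2\times2$ block is the map $e_2\mapsto\frac12e_2-\frac14e_4$, $e_4\mapsto\frac12e_4$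
    rewritten in $v_3,v_4$. *)
Lemma soliton_D_represented :
  represented_by (@vframe R) soliton_D (soliton_D_mx R).
Proof.
have s2 := sqrt2_neq0.
by elim/ord4P; rewrite sum_ord4 !vframe_col4; apply/esym/col4P;
  rewrite !(col4E, mxE) /=; field.
Qed.

End Computation.

Theorem theorem4p13 (R : realType)
    (J : {linear 'cV[R]_4 -> 'cV[R]_4})
    (nabla : 'cV[R]_4 -> 'cV[R]_4 -> 'cV[R]_4)
    (Ric0 : 'cV[R]_4 -> 'cV[R]_4)
    (hJ : is_product_structure_J J)
    (hnabla : is_levi_civita (@h3R_bracket R) (@S03 R) nabla)
    (hRic0 : is_sym_ricci_op (@h3R_bracket R) (@S03 R) (@vframe R)
               (canonical_connection nabla J) Ric0) :
  algebraic_ricci_soliton (@h3R_bracket R) Ric0 (- (5 / 8)) /\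
  exists D : {linear 'cV[R]_4 -> 'cV[R]_4},
    [/\ represented_by (@vframe R) D (soliton_D_mx R),
        is_derivation (@h3R_bracket R) D
      & forall u, Ric0 u = - (5 / 8) *: u + D u].
Proof.
have D u : Ric0 u = - (5 / 8) *: u + soliton_D u.
  rewrite (canonical_sym_ricci_opE hJ hnabla hRic0).
  by apply/esym/col4P; rewrite !(col4E, mxE); field.
by split; exists (@soliton_D R); split=> //;
  [exact: soliton_D_derivation | exact: soliton_D_represented
  | exact: soliton_D_derivation].
Qed.
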